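(* Let $\mathfrak{a}\subseteq\mathbb{Z}[x_1,\ldots,x_n]$ be a nonzero ideal such that $\mathbb{Z}[x_1,\ldots,x_n]/\mathfrak{a}$ is a finitely generated $\mathbb{Z}$-module. If the short reduced Gröbner basis of $\mathfrak{a}$ with respect to some monomial ordering is monic, then every ideal in the $\mathbb{Z}$-module $\mathbb{Z}[x_1,\ldots,x_n]/\mathfrak{a}$ is an ideal lattice.
   Context: An integer lattice is an additive subgroup of $\mathbb{Z}^N$ for some $N\in\mathbb{N}$. An ideal $\mathfrak{A}$ of $\mathbb{Z}[x_1,\ldots,x_n]/\mathfrak{a}$ is called a (multivariate) ideal lattice if it is isomorphic, as a $\mathbb{Z}$-module, to an integer lattice $\mathcal{L}\subseteq\mathbb{Z}^N$ for some $N$. Short reduced Gröbner basis over $\mathbb{Z}$: fix a monomial order $\prec$, with leading monomial $\mathrm{lm}$, leading coefficient $\mathrm{lc}$ and leading term $\mathrm{lt}=\mathrm{lc}\cdot\mathrm{lm}$. A finite set $G\subseteq\mathfrak{a}$ is a Gröbner basis of $\mathfrak{a}$ if the ideal generated by $\{\mathrm{lt}(g):g\in G\}$ equals the ideal generated by $\{\mathrm{lt}(f):f\in\mathfrak{a}\setminus\{0\}\}$. For a monomial $x^\alpha$ the leading coefficient ideal is $I_{x^\alpha}=\langle \mathrm{lc}(g): g\in G,\ \mathrm{lm}(g)\mid x^\alpha\rangle\subseteq\mathbb{Z}$. A short reduced Gröbner basis is a reduced Gröbner basis (no redundant elements; non-leading terms reduced modulo $G$) in which, for each $x^\alpha\in\mathrm{lm}(G)$,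 the generating set of $I_{x^\alpha}$ has minimal length; over $\mathbb{Z}$ this means that for each $x^\alpha \in \mathrm{lm}(G)$ there is a single element of $G$ with leading monomial $x^\alpha$ and its leading coefficient is the (positive) gcd generating $I_{x^\alpha}$. It is unique for a given monomial order. It is called monic if the leading coefficients of all its elements equal $1$. *)

(* Defs.v *)
From HB Require Import structures.
From mathcomp Require Import all_boot all_order all_algebra.
From mathcomp Require Import generic_quotient ring_quotient.
From mathcomp Require Import mpoly.
From mathcomp Require boolp.

Set Implicit Arguments.
Unset Strict Implicit.
Unset Printing Implicit Defensive.

Import Order.TTheory GRing.Theory Num.Theory.

Local Open Scope ring_scope.
Local Open Scope quotient_scope.

(* The library's [idealr] only covers proper ideals; here the unit ideal is
   allowed, and the zero ring is allowed as ambient ring. *)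
HB.mixin Record isAbsorbing (R : comPzRingType) (S : R -> bool) := {
  absorbing_subproof : forall a, {in S, forall u, a * u \in S}
}.

#[short(type="ideal")]
HB.structure Definition Ideal (R : comPzRingType) :=
  {S of GRing.ZmodClosed R S & isAbsorbing R S}.

(* Ideals being boolean predicates is no restriction, classically. *)
Lemma ideal_of_Prop (R : comPzRingType) (P : R -> Prop) :
    P 0 -> (forall x y, P x -> P y -> P (x + y)) ->
    (forall a x, P x -> P (a * x)) ->
  exists I : ideal R, forall x, x \in I <-> P x.
Proof.
move=> P0 PD PM; pose S (x : R) := boolp.asbool (P x).
have SE x : x \in S <-> P x by split=> /boolp.asboolP.
have Sz : zmod_closed S.
  split=> [|x y /SE Px /SE Py]; first exact/SE.
  by apply/SE/PD => //; rewrite -mulN1r; apply: PM.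
have Sa a : {in S, forall u, a * u \in S} by move=> u /SE Pu; apply/SE/PM.
pose Sz' := GRing.isZmodClosed.Build R S Sz.
pose Sa' := isAbsorbing.Build R S Sa.
pose I : ideal R := HB.pack S Sz' Sa'.
by exists I.
Qed.

(* The ring R / I, on the carrier of the library quotient; it is the zero ring
   when I = R. *)
Section QuotientRing.
Variables (R : comPzRingType) (I : ideal R).

Definition quotient_ring : Type := Quotient.quot I.

HB.instance Definition _ := GRing.Zmodule.on quotient_ring.
HB.instance Definition _ := EqQuotient.on quotient_ring.

Definition quotient_one : quotient_ring := \pi_quotient_ring 1.
Definition quotient_mul (u v : quotient_ring) : quotient_ring :=
  \pi_quotient_ring (repr u * repr v).

Lemma quotient_eqE (x y : R) :
  (\pi_quotient_ring x == \pi_quotient_ring y) = (x - y \in I).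
Proof. by rewrite -[LHS]Quotient.idealrBE. Qed.

Lemma quotient_piD (x y : R) :
  \pi_quotient_ring (x + y) = \pi_quotient_ring x + \pi_quotient_ring y.
Proof. exact: Quotient.pi_add. Qed.

Lemma quotient_piM (x y : R) : \pi_quotient_ring (x * y) =
  quotient_mul (\pi_quotient_ring x) (\pi_quotient_ring y).
Proof.
apply/eqP; rewrite quotient_eqE.
set x' := repr _; set y' := repr _.
have xI : x - x' \in I by rewrite -quotient_eqE reprK.
have yI : y - y' \in I by rewrite -quotient_eqE reprK.
have -> : x * y - x' * y' = y * (x - x') + x' * (y - y').
  by rewrite !mulrBr addrA [y * x]mulrC [y * x']mulrC subrK.
by rewrite rpredD ?absorbing_subproof.
Qed.

Lemma quotient_mulA : associative quotient_mul.
Proof.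
elim/quotW=> x; elim/quotW=> y; elim/quotW=> z.
rewrite -(quotient_piM y z) -(quotient_piM x y).
by rewrite -(quotient_piM x (y * z)) -(quotient_piM (x * y) z) mulrA.
Qed.

Lemma quotient_mulC : commutative quotient_mul.
Proof.
by elim/quotW=> x; elim/quotW=> y; rewrite -(quotient_piM x y) mulrC quotient_piM.
Qed.

Lemma quotient_mul1 : left_id quotient_one quotient_mul.
Proof. by elim/quotW=> x; rewrite -quotient_piM mul1r. Qed.

Lemma quotient_mulDl : left_distributive quotient_mul +%R.
Proof.
elim/quotW=> x; elim/quotW=> y; elim/quotW=> z.
rewrite -(quotient_piD x y) -(quotient_piM (x + y) z).
by rewrite -(quotient_piM x z) -(quotient_piM y z) -quotient_piD mulrDl.
Qed.

HB.instance Definition _ := GRing.Zmodule_isComPzRing.Build quotient_ring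
  quotient_mulA quotient_mulC quotient_mul1 quotient_mulDl.

End QuotientRing.

Definition generated_ideal (R : comPzRingType) (S : R -> Prop) (f : R) : Prop :=
  exists s : seq (R * R),
    (forall p, p \in s -> S p.2) /\ f = \sum_(p <- s) p.1 * p.2.

Definition finitely_generated (V : zmodType) : Prop :=
  exists (m : nat) (s : m.-tuple V), forall v, inIntSpan s v.

(* Z-linear maps between abelian groups are the additive ones; only the values
   of [phi] on [A] matter. *)
Definition subgroup_isomorphic (V W : zmodType)
    (A : zmodClosed V) (L : zmodClosed W) : Prop :=
  exists phi : V -> W,
    [/\ {in A &, {morph phi : u v / u + v}},
        {in A &, injective phi} &
        forall w, w \in L <-> exists2 u, u \in A & phi u = w].

Definition ideal_lattice (Q : comPzRingType) (A : ideal Q) : Prop :=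
  exists (N : nat) (L : zmodClosed 'rV[int]_N), subgroup_isomorphic A L.

(* The order [ord m1 m2] reads "m1 is at most m2"; monomials are written
   additively, as exponent vectors. *)
Record monomial_order (n : nat) (ord : rel 'X_{1..n}) : Prop := MonomialOrder {
  mo_refl : reflexive ord;
  mo_anti : antisymmetric ord;
  mo_trans : transitive ord;
  mo_total : total ord;
  mo_add : forall m m1 m2, ord m1 m2 -> ord (m + m1)%MM (m + m2)%MM;
  mo_wf : well_founded (fun m1 m2 => (m1 != m2) && ord m1 m2)
}.

Section Groebner.
Variables (n : nat) (ord : rel 'X_{1..n}).
Implicit Types (f g : {mpoly int[n]}) (G : seq {mpoly int[n]}).

(* The library's [mlead] is tied to one fixed order. The neutral value 0 is the
   least monomial for any monomial order. *)
Definition lead_monom f : 'X_{1..n} :=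
  \big[(fun m1 m2 => if ord m1 m2 then m2 else m1)/0%MM]_(m <- msupp f) m.

Definition lead_coeff f : int := f@_(lead_monom f).

Definition lead_term f : {mpoly int[n]} := lead_coeff f *: 'X_[lead_monom f].

Definition groebner_basis (a : ideal {mpoly int[n]}) G : Prop :=
  {subset G <= a} /\
  forall f, generated_ideal (fun t => exists2 g, g \in G & t = lead_term g) f <->
            generated_ideal
              (fun t => exists2 g, (g \in a) && (g != 0) & t = lead_term g) f.

Definition lc_ideal G (m : 'X_{1..n}) : int -> Prop :=
  generated_ideal
    (fun c => exists2 g,
       (g \in G) && (lead_monom g <= m)%MM & c = lead_coeff g).

(* The coset representatives modulo a nonzero leading coefficient ideal dZ,
   with d > 0, are 0, ..., d - 1. If the ideal is zero there is no condition. *)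
Definition coef_reduced G (m : 'X_{1..n}) (c : int) : Prop :=
  forall d : int, 0 < d -> lc_ideal G m d -> 0 <= c < d.

Definition reduced_groebner_basis (a : ideal {mpoly int[n]}) G : Prop :=
  [/\ groebner_basis a G,
      forall g, g \in G -> ~ groebner_basis a [seq h <- G | h != g] &
      forall g m, g \in G -> m \in msupp g -> m != lead_monom g ->
        coef_reduced G m g@_m].

Definition short_reduced_groebner_basis (a : ideal {mpoly int[n]}) G : Prop :=
  [/\ reduced_groebner_basis a G,
      {in G &, injective lead_monom} &
      forall g, g \in G ->
        0 < lead_coeff g /\
        forall c : int, lc_ideal G (lead_monom g) c <-> (lead_coeff g %| c)%Z].

Definition monic_basis G : Prop := forall g, g \in G -> lead_coeff g = 1.

End Groebner.

(* Main.v *)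
Require Import Defs.
From HB Require Import structures.
From mathcomp Require Import all_boot all_order all_algebra.
From mathcomp Require Import generic_quotient.
From mathcomp Require Import mpoly.
From mathcomp Require boolp.

Import GRing.Theory Num.Theory.

Local Open Scope ring_scope.
Local Open Scope quotient_scope.

(** Reduction modulo a monic Gröbner basis never divides by a coefficient, so
    [d * f \in a] with [d != 0] forces [f \in a]: the leading monomial of [f],
    being that of [d * f], is divisible by some [lead_monom g], and subtracting
    the matching multiple of [g] lowers the leading monomial of [f].  Hence the
    quotient is torsion-free.  A finitely generated torsion-free group [V] embeds
    in some Z^N: a maximal independent family of generators gives an injection
    [psi : Z^N -> V] and some [D > 0] with [D * V] contained in its image, and
    [v |-> psi^-1 (D * v)] is the embedding. *)

Definition torsion_free (V : zmodType) : Prop :=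
  forall (v : V) (d : nat), (0 < d)%N -> v *+ d = 0 -> v = 0.

Section TorsionFree.
Variables (V : zmodType) (V_tf : torsion_free V).

Lemma torsion_free_intmul (v : V) (k : int) : k != 0 -> v *~ k = 0 -> v = 0.
Proof.
case: k => [[|d]|d] // _; first exact: V_tf.
by rewrite NegzE mulrNz => /eqP; rewrite oppr_eq0 => /eqP; apply: V_tf.
Qed.

(** Induction on [s]: an element with a nonzero multiple in the image of [psi] only enlarges [D];
    any other one adds a coordinate to [psi]. *)
Lemma torsion_free_maximal_independent (s : seq V) :
  exists (N : nat) (psi : {additive 'rV[int]_N -> V}) (D : int),
    [/\ injective psi, D != 0 &
        forall v, v \in s -> exists c, psi c = v *~ D].
Proof.
elim: s => [|x s [N [psi [D [psi_inj D0 sD]]]]].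
  exists 0%N, (\0 : {additive 'rV[int]_0 -> V}), 1.
  by split=> // c c' _; rewrite [c]thinmx0 [c']thinmx0.
case: (boolp.pselect (exists k c, k != 0 /\ psi c = x *~ k)).
  (* Since [x *~ k] is in the image, [D * k] serves both [x] and the earlier elements. *)
  case=> k [c [k0 ck]]; exists N, psi, (D * k).
  split=> // [|v]; first by rewrite mulf_neq0.
  rewrite inE => /predU1P[->|/sD[c' c'D]].
    by exists (c *~ D); rewrite raddfMz ck -mulrzA mulrC.
  by exists (c' *~ k); rewrite raddfMz c'D -mulrzA.
move=> x_indep.
pose psi' (c : 'rV[int]_(1 + N)) := x *~ lsubmx c 0 0 + psi (rsubmx c).
have psi'B : zmod_morphism psi'.
  move=> c c'; rewrite /psi' !raddfB /= !mxE mulrzBr.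
  by rewrite opprD addrACA.
pose psi'A := GRing.isZmodMorphism.Build _ _ psi' psi'B.
pose Psi : {additive 'rV[int]_(1 + N) -> V} := HB.pack psi' psi'A.
exists (1 + N)%N, Psi, D; split=> //.
  (* A kernel vector with nonzero first coordinate would put a nonzero multiple of [x] in the image
     of [psi]. *)
  apply: raddf_inj => c /= c0.
  have l0 : lsubmx c 0 0 = 0.
    apply/eqP/negPn/negP => k0; apply: x_indep.
    exists (lsubmx c 0 0), (- rsubmx c); split=> //.
    by rewrite raddfN; apply/esym/eqP; rewrite -subr_eq0 opprK; apply/eqP.
  have r0 : rsubmx c = 0.
    by apply: psi_inj; rewrite raddf0 -c0 /= /psi' l0 mulr0z add0r.
  rewrite -[c]hsubmxK r0.
  have -> : lsubmx c = 0 by apply/rowP => i; rewrite ord1 l0 mxE.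
  exact: row_mx0.
move=> v; rewrite inE => /predU1P[->|/sD[c cD]].
  exists (row_mx (const_mx D) 0).
  by rewrite /= /psi' row_mxKl row_mxKr mxE raddf0 addr0.
exists (row_mx 0 c).
by rewrite /= /psi' row_mxKl row_mxKr mxE mulr0z add0r.
Qed.

Lemma finitely_generated_torsion_free_embedding :
  finitely_generated V ->
  exists (N : nat) (phi : {additive V -> 'rV[int]_N}), injective phi.
Proof.
case=> m [s sV].
have [N [psi [D [psi_inj D0 sD]]]] := torsion_free_maximal_independent s.
have VD v : exists c, psi c = v *~ D.
  have [b ->] := sV v.
  have si (i : 'I_m) : exists c, psi c = s`_i *~ D.
    by apply: sD; rewrite mem_nth // size_tuple.
  have [c cD] := boolp.choice si.
  exists (\sum_i c i *~ b i); rewrite raddf_sum mulrz_suml.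
  by apply: eq_bigr => i _; rewrite raddfMz cD -!mulrzA mulrC.
(* [phi v] is the unique preimage of [v *~ D]; injectivity of [psi] makes [phi] additive. *)
have [phi phiD] := boolp.choice VD.
have phiB : zmod_morphism phi.
  by move=> u v; apply: psi_inj; rewrite raddfB !phiD mulrzBl.
pose phiA := GRing.isZmodMorphism.Build _ _ phi phiB.
pose Phi : {additive V -> 'rV[int]_N} := HB.pack phi phiA.
exists N, Phi; apply: raddf_inj => v /= v0.
by apply: (@torsion_free_intmul _ D) => //; rewrite -phiD v0 raddf0.
Qed.

(** Take for [L] the image of [A] under the embedding of [V], made boolean classically. *)
Lemma finitely_generated_torsion_free_subgroup (A : zmodClosed V) :
  finitely_generated V ->
  exists (N : nat) (L : zmodClosed 'rV[int]_N), subgroup_isomorphic A L.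
Proof.
move=> /finitely_generated_torsion_free_embedding[N [phi phi_inj]].
pose L w := boolp.asbool (exists2 u, u \in A & phi u = w).
have LP w : w \in L <-> exists2 u, u \in A & phi u = w.
  by split=> /boolp.asboolP.
have L_closed : zmod_closed L.
  split=> [|_ _ /LP[u uA <-] /LP[v vA <-]]; apply/LP.
    by exists 0; rewrite ?rpred0 ?raddf0.
  by exists (u - v); rewrite ?rpredB ?raddfB.
pose LA := GRing.isZmodClosed.Build _ L L_closed.
pose L' : zmodClosed 'rV[int]_N := HB.pack L LA.
exists N, L', phi; split=> // [u v _ _|u v _ _]; first exact: raddfD.
exact: phi_inj.
Qed.

End TorsionFree.

Section MonomialOrder.
Context {n : nat} {ord : rel 'X_{1..n}} (ordP : monomial_order ord).
Implicit Types (f g : {mpoly int[n]}) (m : 'X_{1..n}).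

(** If [m] is below 0, then [m + m] is below [m], strictly unless [m] is 0; well-founded induction
    puts 0 below [m + m], hence below [m]. *)
Lemma monomial_order_ge0 m : ord 0%MM m.
Proof.
elim/(well_founded_ind (mo_wf ordP)): m => m IH.
have /orP[//|m0] := mo_total ordP 0%MM m.
have [->|mN0] := eqVneq m 0%MM; first exact: mo_refl.
have m2 : ord (m + m)%MM m by rewrite -{3}[m]addm0; apply: mo_add.
apply: (mo_trans ordP) (m2); apply: IH; rewrite m2 andbT.
by apply: contra mN0 => /eqP; rewrite -{3}[m]addm0 => /addmI ->.
Qed.

Lemma lead_monom_ge f m : m \in msupp f -> ord m (lead_monom ord f).
Proof.
rewrite /lead_monom; elim: (msupp f) => // k s.
rewrite inE big_cons; set l := \big[_/_]_(j <- s) j => IH.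
have := mo_total ordP k l; case: ifP => // kl /= lk.
  by case/predU1P=> [->|/IH].
case/predU1P=> [->|/IH ml]; first exact: mo_refl.
exact: (mo_trans ordP) ml lk.
Qed.

Lemma lead_monom_supp f : f != 0 -> lead_monom ord f \in msupp f.
Proof.
rewrite -msupp_eq0 /lead_monom; elim: (msupp f) => // k [|k' s] IH _.
  (* The last monomial [k] is compared with the starting value 0; if 0 wins, then [k] is 0, because
     0 is least. *)
  rewrite big_cons big_nil mem_seq1; case: ifP => // k0.
  by apply/eqP/(mo_anti ordP); rewrite k0 monomial_order_ge0.
by rewrite big_cons inE; case: ifP => _; rewrite ?eqxx // IH ?orbT.
Qed.

Lemma eq_lead_monom f g :
  msupp f =i msupp g -> lead_monom ord f = lead_monom ord g.
Proof.
move=> fg; have [f0|fN0] := eqVneq f 0.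
  have [-> | gN0] := eqVneq g 0; first by rewrite f0.
  by have := lead_monom_supp _ gN0; rewrite -fg f0 msupp0.
have gN0 : g != 0.
  by apply: contraTneq (lead_monom_supp _ fN0) => g0; rewrite fg g0 msupp0.
apply: (mo_anti ordP); rewrite !lead_monom_ge //; [rewrite fg|rewrite -fg];
  exact: lead_monom_supp.
Qed.

(** Shaped for the relation of [mo_wf]: cancelling the coefficient at [m] gives a strict descent. *)
Lemma lead_monom_lt f m : f != 0 ->
  (forall k, k \in msupp f -> ord k m) -> f@_m = 0 ->
  (lead_monom ord f != m) && ord (lead_monom ord f) m.
Proof.
move=> fN0 f_le fm; have fl := lead_monom_supp _ fN0.
by rewrite f_le // andbT; apply: contraTneq fl => ->; rewrite -mcoeff_eq0 fm.
Qed.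

(** The leading term of [f] is a combination of leading terms of [G]. Some summand has a nonzero
    coefficient at [m], and all its monomials are multiples of [lead_monom ord g]. *)
Lemma monic_groebner_divides (a : ideal {mpoly int[n]}) G f :
    groebner_basis ord a G -> monic_basis ord G -> f \in a -> f != 0 ->
  exists2 g, g \in G & (lead_monom ord g <= lead_monom ord f)%MM.
Proof.
move=> [_ Ga] G1 fa f0; set m := lead_monom ord f.
have /Ga[s [sG fs]] : generated_ideal
    (fun t => exists2 g, (g \in a) && (g != 0) & t = lead_term ord g)
    (lead_term ord f).
  exists [:: (1, lead_term ord f)]; split; last by rewrite big_seq1 mul1r.
  by move=> p; rewrite mem_seq1 => /eqP ->; exists f; rewrite ?fa.
have : (lead_term ord f)@_m != 0.
  by rewrite mcoeffZ mcoeffX eqxx mulr1 -mcoeff_msupp lead_monom_supp.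
rewrite fs => sm.
have /hasP[p ps pm] : has (fun p => (p.1 * p.2)@_m != 0) s.
  apply: contraNT sm => /hasPn s0; rewrite raddf_sum big_seq big1 //= => p ps.
  by apply/eqP/negPn/s0.
have [g gG gp] := sG p ps; exists g => //.
move: pm; rewrite gp /lead_term G1 // scale1r -mcoeff_msupp.
by rewrite (perm_mem (msuppMX _ _)) => /mapP[k _ ->]; apply: lem_addr.
Qed.

Lemma monic_groebner_saturated (a : ideal {mpoly int[n]}) G f (d : nat) :
    groebner_basis ord a G -> monic_basis ord G ->
    (0 < d)%N -> f *+ d \in a -> f \in a.
Proof.
move=> Ga G1 d0; move: {2}(lead_monom ord f) (erefl (lead_monom ord f)) => m.
elim/(well_founded_ind (mo_wf ordP)): m f => m IH f fm fda.
have [->|f0] := eqVneq f 0; first exact: rpred0.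
have fd_supp : msupp (f *+ d) =i msupp f.
  by move=> k; rewrite !mcoeff_msupp mcoeffMn mulrn_eq0 -leqn0 leqNgt d0.
have fd0 : f *+ d != 0.
  by rewrite -msupp_eq0; apply: contraTneq (lead_monom_supp _ f0) => fd;
    rewrite -fd_supp fd.
have [g gG] := monic_groebner_divides _ _ _ Ga G1 fda fd0.
rewrite (eq_lead_monom _ _ fd_supp) fm => gm.
(* As [g] is monic, [h] has the same coefficient as [f] at [m], without any division. *)
pose h := (f@_m *: 'X_[m - lead_monom ord g]) * g.
have ha : h \in a by apply: absorbing_subproof; apply: (proj1 Ga).
have hE k : h@_(m - lead_monom ord g + k) = f@_m * g@_k.
  by rewrite /h -scalerAl mcoeffZ [_ * g]mulrC mcoeffMX.
suff : f - h \in a by move=> fha; rewrite -[f](subrK h) rpredD.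
have [->|fh0] := eqVneq (f - h) 0; first exact: rpred0.
apply: IH (erefl _) _; last by rewrite mulrnBl rpredB // rpredMn.
(* The coefficients at [m] cancel, and every monomial of [f] or [h] is at most [m]. *)
apply: lead_monom_lt => // [k|]; last first.
  by rewrite mcoeffB -{2}(submK gm) hE [g@__]G1 // mulr1 subrr.
move=> /msuppB_le; rewrite mem_cat => /orP[|].
  by rewrite -fm; apply: lead_monom_ge.
rewrite /h -scalerAl => /msuppZ_le.
rewrite [_ * g]mulrC (perm_mem (msuppMX _ _)).
move=> /mapP[j /lead_monom_ge jg ->].
by rewrite -{2}(submK gm); apply: mo_add.
Qed.

End MonomialOrder.

(** If [d] kills the class of [f], then [f *+ d] lies in [a], and so does [f] by saturation. *)
Lemma quotient_torsion_free (R : comPzRingType) (a : ideal R) :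
  (forall f (d : nat), (0 < d)%N -> f *+ d \in a -> f \in a) ->
  torsion_free (quotient_ring a).
Proof.
move=> a_sat; elim/quotW=> f d d0.
have pi0 : \pi_(quotient_ring a) 0 = 0 :> quotient_ring a.
  by apply: (addrI (\pi_(quotient_ring a) 0)); rewrite -quotient_piD !addr0.
have -> : \pi_(quotient_ring a) f *+ d = \pi_(quotient_ring a) (f *+ d).
  by elim: d {d0} => [|d IH]; rewrite ?pi0 // !mulrS IH quotient_piD.
rewrite -pi0 => /eqP; rewrite quotient_eqE subr0 => /a_sat fa.
by apply/eqP; rewrite quotient_eqE subr0 fa.
Qed.

Theorem theorem4p4 (n : nat) (a : ideal {mpoly int[n]})
    (a_neq0 : exists2 f : {mpoly int[n]}, f \in a & f != 0)
    (a_fg : finitely_generated (quotient_ring a))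
    (a_monic : exists (ord : rel 'X_{1..n}) (G : seq {mpoly int[n]}),
        [/\ monomial_order ord,
            short_reduced_groebner_basis ord a G &
            monic_basis ord G]) :
  forall A : ideal (quotient_ring a), ideal_lattice A.
Proof.
move=> A; have [ord [G [ordP [[Ga _ _] _ _] G1]]] := a_monic.
(* [A] is in particular a subgroup of the quotient, so it remains to exclude torsion there. *)
apply: finitely_generated_torsion_free_subgroup a_fg.
apply: quotient_torsion_free => f d; exact: monic_groebner_saturated Ga G1.
Qed.
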